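(* Let $A$ be a finite set of prisoners with $|A|\ge2$, $K$ a finite set of colors with $3\le|K|$, $V$ a visibility graph on $A$, and $I$ an inning function on $A$ with $IN\ge2$. Suppose the hat game $\mathcal{G}=(A,K,V,I)$ satisfies (S3) for every $a\in A$, $V(a)\cap H(a)=\emptyset$. If $\mathcal{G}$ has a predictor under which, for every coloring, at most one prisoner guesses incorrectly, then $\mathcal{G}$ satisfies (S1) $|I_1|=1$, and (S2) for every $a\in A$, $V(a)\cup H(a)=A\setminus\{a\}$.
   Context: A hat game $(A,K,V,I)$ consists of: a set $A$ of prisoners and a set $K$ of colors (with $|A|,|K|\ge2$); a visibility graph $V\subseteq A^2$ with no loops, where $(a,b)\in V$ means $a$ sees $b$'s hat, and $V(a)=\{b:(a,b)\in V\}$; and an inning function $I$, a surjection from $A$ onto $\{\beta:1\le\beta\le\alpha\}$ for some nonzero ordinal $\alpha$. Write $IN=\max\operatorname{ran}(I)$, $I_\beta=\{a:I(a)=\beta\}$, and $H(a)=\{b:I(b)<I(a)\}$. A coloring is $f\in K^A$. Strategies: for each $a$, a function $S_a:K^{H(a)}\times K^{V(a)}\to K$; guesses are defined by recursion on $I(a)$ as $\sigma_a(f)=S_a(h_a^f,f\restriction V(a))$ with $h_a^f=(\sigma_b(f))_{b\in H(a)}$. A predictor is $P:K^A\to K^A$ with $P(f)(a)=\sigma_a(f)$ for some family of strategies. Prisoner $a$ guesses incorrectly under $f$ if $P(f)(a)\ne f(a)$. *)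

(* Defs.v *)
From mathcomp Require Import all_boot.
From Stdlib Require Import Wf_nat.

Set Implicit Arguments.
Unset Strict Implicit.
Unset Printing Implicit Defensive.

(* Hat games with a finite set A of prisoners and a finite set K of colors.
   Since A is finite, an ordinal alpha such that A surjects onto
   {beta : 1 <= beta <= alpha} is finite, so innings are natural numbers. *)

Section HatGame.

Variables A K : finType.
Variable V : rel A. (* V a b: prisoner a sees the hat of prisoner b *)
Variable I : A -> nat.

Definition visibility_graph : Prop := irreflexive V.

Definition inning_function : Prop :=
  exists alpha : nat,
    [/\ alpha <> 0,
        forall a, 1 <= I a <= alpha
      & forall beta, 1 <= beta <= alpha -> exists a, I a = beta].

Definition last_inning : nat := \max_(a : A) I a.

Definition inning (beta : nat) : {set A} := [set a | I a == beta].

Definition seen (a : A) : {set A} := [set b | V a b].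

Definition heard (a : A) : {set A} := [set b | I b < I a].

Definition coloring := {ffun A -> K}.

Definition strategies := forall a : A,
  {ffun {b : A | b \in heard a} -> K} ->
  {ffun {b : A | b \in seen a} -> K} -> K.

Lemma heard_lt (a : A) (b : {b : A | b \in heard a}) : ltof A I (val b) a.
Proof. by apply/ltP; have := valP b; rewrite inE. Qed.

Definition guess_step (S : strategies) (f : coloring) (a : A)
    (rec : forall b : A, ltof A I b a -> K) : K :=
  S a [ffun b : {b : A | b \in heard a} => rec (val b) (heard_lt b)]
      [ffun b : {b : A | b \in seen a} => f (val b)].

Definition guess (S : strategies) (f : coloring) : A -> K :=
  Fix (well_founded_ltof A I) (fun _ => K) (guess_step S f).

Lemma guessE (S : strategies) (f : coloring) (a : A) :
  guess S f a =
  S a [ffun b : {b : A | b \in heard a} => guess S f (val b)]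
      [ffun b : {b : A | b \in seen a} => f (val b)].
Proof.
rewrite /guess Fix_eq // => x g h gh.
by congr (S x _ _); apply/ffunP => b; rewrite !ffunE gh.
Qed.

Definition is_predictor (P : coloring -> coloring) : Prop :=
  exists S : strategies, forall f a, P f a = guess S f a.

Definition wrong_guessers (P : coloring -> coloring) (f : coloring) : {set A} :=
  [set a | P f a != f a].

End HatGame.

(* Main.v *)
Require Import Defs.
From mathcomp Require Import all_boot.

(** If two prisoners guess in the first inning, each of them is right only on
    the graph of a function of the other's hat color; with three colors some
    coloring avoids both graphs, so both are wrong.  Hence a single prisoner
    [a0] opens the game.  By (S3) nobody sees his hat, so it can be recolored to
    make him wrong without affecting any other guess: all others are always
    right.  Their announcements are then just their own hats, and the only
    additional information is the announcement of [a0].  If [a <> a0] neither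
    sees nor hears [b], that announcement must determine the color of [a]; by
    finiteness it is then itself determined by the color of [a], and nothing is
    left to tell [b] his color. *)

Set Implicit Arguments.
Unset Strict Implicit.
Unset Printing Implicit Defensive.

Lemma exists_notin (T : finType) (s : seq T) :
  size s < #|T| -> exists x, x \notin s.
Proof.
move=> ltsT; apply/existsP; rewrite -negb_forall; apply/negP => /forallP sT.
have /leq_trans/(_ (card_size s)) : #|T| <= #|s|.
  by apply/subset_leq_card/subsetP => x _; exact: sT.
by rewrite leqNgt ltsT.
Qed.

Section Recolor.

Variables A K : finType.

Definition recolor (f : coloring A K) (a : A) (x : K) : coloring A K :=
  [ffun b => if b == a then x else f b].

Lemma recolor_eq f a x : recolor f a x a = x.
Proof. by rewrite ffunE eqxx. Qed.

Lemma recolor_neq f a x b : b != a -> recolor f a x b = f b.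
Proof. by rewrite ffunE => /negbTE->. Qed.

End Recolor.

Section Game.

Variables (A K : finType) (V : rel A) (I : A -> nat) (S : strategies K V I).
Hypothesis Virr : irreflexive V.

Lemma eq_guess (f g : coloring A K) (a : A) :
  (forall b, I b < I a -> guess S f b = guess S g b) ->
  (forall b, V a b -> f b = g b) ->
  guess S f a = guess S g a.
Proof.
move=> eqH eqV; rewrite !guessE; congr (S _ _).
  by apply/ffunP => -[b bP]; rewrite !ffunE eqH //=; move: (bP); rewrite inE.
by apply/ffunP => -[b bP]; rewrite !ffunE eqV //=; move: (bP); rewrite inE.
Qed.

Hypothesis K3 : 3 <= #|K|.
Hypothesis wrong1 : forall (f : coloring A K) a b,
  guess S f a != f a -> guess S f b != f b -> a = b.

Lemma first_guesser_uniq a b :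
  (forall c, I a <= I c) -> (forall c, I b <= I c) -> a = b.
Proof.
move=> amin bmin; apply/eqP/negPn/negP => ab.
have [y1 _] : exists y, y \notin ([::] : seq K).
  by apply: exists_notin; apply: leq_trans K3.
have [y2 y21] : exists y, y \notin [:: y1].
  by apply: exists_notin; apply: leq_trans K3.
pose f x y : coloring A K := recolor (recolor [ffun=> y1] a x) b y.
have fa x y : f x y a = x by rewrite recolor_neq // recolor_eq.
have fb x y : f x y b = y by rewrite recolor_eq.
have guess_a x x' y : guess S (f x y) a = guess S (f x' y) a.
  apply: eq_guess => [c|c Vac]; first by rewrite ltnNge amin.
  rewrite !ffunE; case: (c == b) => //; case: eqP => // ca.
  by rewrite ca Virr in Vac.
have guess_b x y y' : guess S (f x y) b = guess S (f x y') b.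
  apply: eq_guess => [c|c Vbc]; first by rewrite ltnNge bmin.
  rewrite !ffunE; case: eqP => // cb.
  by rewrite cb Virr in Vbc.
(* The guess of [a] ignores his own hat, so only two guesses arise as [y] ranges over [y1], [y2]. A
   third color [x] makes him wrong for either choice of [y]. *)
have [x] : exists x, x \notin [:: guess S (f y1 y1) a; guess S (f y1 y2) a].
  exact: exists_notin.
rewrite !inE negb_or => /andP[xy1 xy2].
(* With [x] fixed, the guess of [b] is the same for [y1] and [y2], so it misses one of them. *)
have [y ya yb] : exists2 y, x != guess S (f y1 y) a & y != guess S (f x y1) b.
  have [eq_y1|ne_y1] := eqVneq y1 (guess S (f x y1) b); last by exists y1.
  by exists y2; rewrite // -eq_y1; rewrite inE in y21.
by case/eqP: ab; apply: (wrong1 (f := f x y));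
   rewrite eq_sym ?fa ?fb ?(guess_a x y1) ?(guess_b x y y1).
Qed.

Variable a0 : A.
Hypothesis a0_first : forall b, b != a0 -> I a0 < I b.
Hypothesis VH : forall a b, V a b -> ~~ (I b < I a).

Lemma unseen_first b : ~~ V b a0.
Proof.
have [->|/a0_first a0b] := eqVneq b a0; first by rewrite Virr.
by apply: contraL a0b; exact: VH.
Qed.

(** Induction on innings: no prisoner sees [a0], and the guesses he hears are unchanged by
    induction. *)
Lemma guess_recolor_first f x b : guess S (recolor f a0 x) b = guess S f b.
Proof.
have [n] := ubnP (I b); elim: n b => // n IHn b /ltnSE lebn.
apply: eq_guess => c => [cb|Vbc]; first exact: IHn (leq_trans cb lebn).
by rewrite recolor_neq //; apply: contraTneq Vbc => ->; exact: unseen_first.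
Qed.

(** Recoloring [a0] away from his own guess uses up the single permitted error, while [b] still
    makes the same guess about the same hat. *)
Lemma guess_nonfirst f b : b != a0 -> guess S f b = f b.
Proof.
move=> ba0.
have [x] : exists x, x \notin [:: guess S f a0].
  by apply: exists_notin; apply: leq_trans K3.
rewrite inE eq_sym => wrong_a0; apply/eqP; apply: contraNT ba0 => wrong_b.
apply/eqP; apply: (wrong1 (f := recolor f a0 x)); rewrite guess_recolor_first.
  have [->|ba0] := eqVneq b a0; first by rewrite recolor_eq.
  by rewrite recolor_neq.
by rewrite recolor_eq.
Qed.

(** Since [guess_nonfirst] turns guesses into hats, what [a] hears amounts to the guess of [a0] and
    the true colors of the other earlier prisoners. *)
Lemma color_determined f g a : a != a0 ->
  guess S f a0 = guess S g a0 ->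
  (forall b, b != a0 -> I b < I a -> f b = g b) ->
  (forall b, V a b -> f b = g b) ->
  f a = g a.
Proof.
move=> aa0 eq0 eqH eqV; rewrite -!guess_nonfirst //.
apply: eq_guess => // b ltba; have [->//|ba0] := eqVneq b a0.
by rewrite !guess_nonfirst // eqH.
Qed.

Lemma seen_or_heard a b : b != a -> V a b || (I b < I a).
Proof.
move=> ba; apply/negPn; rewrite negb_or; apply/negP => /andP[nVab nHab].
have ba0 : b != a0.
  have [<-//|/a0_first a0a] := eqVneq a a0.
  by apply: contraNneq nHab => ->.
have [x0 _] : exists x, x \notin ([::] : seq K).
  by apply: exists_notin; apply: leq_trans K3.
have [y1 /[!inE] y1x0] : exists y, y \notin [:: x0].
  by apply: exists_notin; apply: leq_trans K3.
pose f x y : coloring A K := recolor (recolor [ffun=> x0] a x) b y.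
have fb x y : f x y b = y by rewrite recolor_eq.
have f_neq x y y' c : c != b -> f x y c = f x y' c.
  by move=> cb; rewrite [LHS]recolor_neq // [RHS]recolor_neq.
(* The two colorings differ only at [b], who neither sees nor hears himself. If [a0] announces the
   same in both, [b] cannot tell them apart. *)
suff eq0 : guess S (f x0 y1) a0 = guess S (f x0 x0) a0.
  case/eqP: y1x0; rewrite -(fb x0 y1) -[RHS](fb x0 x0).
  apply: color_determined => // c => [_ cb|Vbc].
    by apply: f_neq; apply: contraTneq cb => ->; rewrite ltnn.
  by apply: f_neq; apply: contraTneq Vbc => ->; rewrite Virr.
(* If [a] is [a0] himself, he hears nobody and does not see [b], so his announcement cannot depend
   on [y]. *)
have [aa0|aa0] := eqVneq a a0.
  apply: eq_guess => c => [|Vac].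
    have [->|/a0_first/ltnW] := eqVneq c a0; first by rewrite ltnn.
    by rewrite leqNgt => /negbTE->.
  by apply: f_neq; apply: contraTneq Vac => ->; rewrite -aa0.
have fa x y : f x y a = x by rewrite recolor_neq 1?eq_sym // recolor_eq.
(* Neither hat that varies is seen or heard by [a], so only the announcement of [a0] can tell him
   [x]. *)
have det_a x y x' y' :
    guess S (f x y) a0 = guess S (f x' y') a0 -> x = x'.
  move=> eq0; rewrite -(fa x y) -[RHS](fa x' y').
  apply: color_determined => // c => [_ ca|Vac]; rewrite !ffunE.
    have [cb|_] := eqVneq c b; first by rewrite -cb ca in nHab.
    by have [ca'|//] := eqVneq c a; rewrite ca' ltnn in ca.
  have [cb|_] := eqVneq c b; first by rewrite -cb Vac in nVab.
  by have [ca|//] := eqVneq c a; rewrite ca Virr in Vac.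
have inj_c : injective (fun x => guess S (f x x0) a0) by move=> x x' /det_a.
(* An injective self-map of the finite set [K] is onto, so the announcement at [(x0, y1)] also
   occurs at some [(x, x0)]; [det_a] then forces [x = x0]. *)
have [x eq0] : exists x, guess S (f x x0) a0 = guess S (f x0 y1) a0.
  by exists (invF inj_c (guess S (f x0 y1) a0)); rewrite (f_invF inj_c).
by rewrite -eq0 (det_a _ _ _ _ eq0).
Qed.

End Game.

Theorem theorem4p7 (A K : finType) (V : rel A) (I : A -> nat)
    (hA : 2 <= #|A|) (hK : 3 <= #|K|)
    (hV : visibility_graph V) (hI : inning_function I)
    (hIN : 2 <= last_inning I)
    (hS3 : forall a : A, seen V a :&: heard I a = set0)
    (hP : exists P : coloring A K -> coloring A K,
        is_predictor V I P /\
        forall f : coloring A K, #|wrong_guessers P f| <= 1) :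
  #|inning I 1| = 1 /\
  (forall a : A, seen V a :|: heard I a = [set: A] :\ a).
Proof.
have [P [[S PS] wrongP]] := hP.
have [alpha [/eqP alpha0 Ialpha Isurj]] := hI.
have Ige1 b : 1 <= I b by have /andP[] := Ialpha b.
have [a0 Ia0] : exists a, I a = 1 by apply: Isurj; rewrite /= lt0n.
have wrong1 (f : coloring A K) a b :
    guess S f a != f a -> guess S f b != f b -> a = b.
  move=> wa wb; have /card_le1_eqP := wrongP f.
  by apply; rewrite inE PS.
(* Innings start at 1, so whoever guesses in inning 1 is a first guesser. *)
have uniq1 b : I b = 1 -> b = a0.
  move=> Ib; apply: (first_guesser_uniq hV hK wrong1) => c.
    by rewrite Ib.
  by rewrite Ia0.
have a0_first b : b != a0 -> I a0 < I b.
  move=> ba0; rewrite Ia0 ltn_neqAle Ige1 andbT eq_sym.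
  by apply: contraNneq ba0 => /uniq1->.
have VH a b : V a b -> ~~ (I b < I a).
  move=> Vab; apply/negP => Hab; have /setP/(_ b) := hS3 a.
  by rewrite !inE Vab Hab.
split.
  suff -> : inning I 1 = [set a0] by rewrite cards1.
  apply/setP => b; rewrite !inE.
  by apply/eqP/eqP => [/uniq1|->].
move=> a; apply/setP => b; rewrite !inE andbT.
have [->|ba] := eqVneq b a; first by rewrite hV ltnn.
by rewrite (seen_or_heard hV hK wrong1 a0_first VH).
Qed.
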